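(* Let $\mathcal{H}$ be a separable complex Hilbert space and let $\{\Lambda_i\}_{i\in J}$, $\Lambda_i\in\mathcal{L}(\mathcal{H},\mathcal{H}_i)$, be a g-frame for $\mathcal{H}$ with respect to $\{\mathcal{H}_i\}_{i\in J}$. Then $\{\Lambda_i\}_{i\in J}$ can be written as a linear combination of two g-orthonormal bases for $\mathcal{H}$ (i.e. there exist g-orthonormal bases $\{\Upsilon_i\}_{i\in J}$, $\{\Gamma_i\}_{i\in J}$ for $\mathcal{H}$ with respect to $\{\mathcal{H}_i\}_{i\in J}$ and scalars $a,b$ such that $\Lambda_i=a\Upsilon_i+b\Gamma_i$ for all $i\in J$) if and only if $\{\Lambda_i\}_{i\in J}$ is a g-Riesz basis for $\mathcal{H}$.
   Context: $J\subseteq\mathbb{Z}$ is an index set, $\{\mathcal{H}_i\}_{i\in J}$ is a sequence of separable complex Hilbert spaces (closed subspaces of some separable Hilbert space $\mathcal{K}$), and $\mathcal{L}(\mathcal{H},\mathcal{H}_i)$ is the set of bounded linear operators $\mathcal{H}\to\mathcal{H}_i$. For a family $\{\Lambda_i\}_{i\in J}$ with $\Lambda_i\in\mathcal{L}(\mathcal{H},\mathcal{H}_i)$: it is a g-frame for $\mathcal{H}$ if there are constants $A,B>0$ with $A\|f\|^2\le\sum_{i\in J}\|\Lambda_if\|^2\le B\|f\|^2$ for all $f\in\mathcal{H}$. It is a g-orthonormal basis for $\mathcal{H}$ if $\langle\Lambda_i^{\star}g_i,\Lambda_j^{\star}g_j\rangle=\delta_{i,j}\langle g_i,g_j\rangle$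 for all $i,j\in J$, $g_i\in\mathcal{H}_i$, $g_j\in\mathcal{H}_j$, and $\sum_{i\in J}\|\Lambda_if\|^2=\|f\|^2$ for all $f\in\mathcal{H}$. It is g-complete if $\bigcap_{i\in J}\{f:\Lambda_if=0\}=\{0\}$. It is a g-Riesz basis for $\mathcal{H}$ if it is g-complete and there are constants $0<A\le B<\infty$ such that for every finite $I\subseteq J$ and all $g_i\in\mathcal{H}_i$, $i\in I$, $A\sum_{i\in I}\|g_i\|^2\le\big\|\sum_{i\in I}\Lambda_i^{\star}g_i\big\|^2\le B\sum_{i\in I}\|g_i\|^2$. *)

(* Defs.v *)
From HB Require Import structures.
From mathcomp Require Import all_boot all_order all_algebra sesquilinear finmap.
From mathcomp Require Import complex.
From mathcomp Require Import all_classical all_reals all_analysis.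
Import numFieldNormedType.Exports.
Import Order.TTheory GRing.Theory Num.Theory.

Set Implicit Arguments.
Unset Strict Implicit.
Unset Printing Implicit Defensive.

Local Open Scope classical_set_scope.
Local Open Scope ring_scope.

(* A complex Hilbert space is a complete normed module over R[i] whose norm is
   induced by an inner product, linear in the first argument. *)
HB.mixin Record CompleteNormedModule_isHilbert (R : realType) V
    & CompleteNormedModule R[i] V := {
  inner : {dot V for (@Num.conj R[i])} ;
  sqr_normE : forall x : V, `|x| ^+ 2 = inner x x
}.

#[short(type="hilbertType")]
HB.structure Definition Hilbert (R : realType) :=
  {V of CompleteNormedModule R[i] V & CompleteNormedModule_isHilbert R V}.

Definition separable (T : topologicalType) : Prop :=
  exists2 D : set T, countable D & dense D.

(* The norm of a normed module over R[i] takes its (real) values in R[i]; this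
   is the same norm, with values in R. *)
Definition rnorm (R : realType) (V : normedModType R[i]) (x : V) : R :=
  complex.Re `|x|.

(* For a linear map, being bounded near 0 amounts to an inequality
   |T x| <= M |x| for all x; see linear_boundedP. *)
Record bounded_op (R : realType) (V W : normedModType R[i]) := BoundedOp {
  op_linear :> {linear V -> W} ;
  op_bounded : bounded_near op_linear (nbhs (0 : V))
}.

Notation "''L' ( V , W )" := (bounded_op V W)
  (at level 0, format "''L' ( V ,  W )") : type_scope.

(* For bounded T on Hilbert spaces the defining set is a singleton, by the Riesz
   representation theorem. *)
Definition adjoint (R : realType) (V W : hilbertType R) (T : 'L(V, W)) (y : W)
  : V := get [set z | forall x : V, inner (T x) y = inner x z].

Section GFrames.
Context (R : realType) (J : set int) (H : hilbertType R)
  (Hs : J -> hilbertType R).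
Implicit Type L : forall i : J, 'L(H, Hs i).

Definition g_frame L : Prop :=
  exists A B : R, [/\ 0 < A, 0 < B & forall f : H,
    ((A * rnorm f ^+ 2)%:E <= \esum_(i in [set: J]) (rnorm (L i f) ^+ 2)%:E
      <= (B * rnorm f ^+ 2)%:E)%E].

(* As distinct Hs i and Hs j share no ambient space, the condition
   <L_i^* g, L_j^* h> = delta_ij <g, h> is split into i = j and i != j. *)
Definition g_orthonormal_basis L : Prop :=
  [/\ forall (i : J) (g h : Hs i),
        inner (adjoint (L i) g) (adjoint (L i) h) = inner g h,
      forall (i j : J) (g : Hs i) (h : Hs j), i != j ->
        inner (adjoint (L i) g) (adjoint (L j) h) = 0
    & forall f : H,
        (\esum_(i in [set: J]) (rnorm (L i f) ^+ 2)%:E)%E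
          = (rnorm f ^+ 2)%:E].

Definition g_complete L : Prop :=
  \bigcap_(i : J) [set f : H | L i f = 0] = [set 0].

Definition g_Riesz_basis L : Prop :=
  g_complete L /\
  exists A B : R, [/\ 0 < A, A <= B &
    forall (I : {fset J}) (g : forall i : J, Hs i),
      A * (\sum_(i <- I) rnorm (g i) ^+ 2)
        <= rnorm (\sum_(i <- I) adjoint (L i) (g i)) ^+ 2
        <= B * (\sum_(i <- I) rnorm (g i) ^+ 2)].

End GFrames.

(* Main.v *)
(* If L = a U + b G with U and G g-orthonormal bases, then identifying H with
   the l^2-sum of the Hs i through U turns the analysis operator of L into
   a + b V, V unitary. This is normal, so the synthesis operator has the norm of
   the analysis operator, and the frame bounds are Riesz bounds.

   Conversely let S f = sum_i L_i^* L_i f be the frame operator, A <= S <= B.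
   Take reals a, b with (a - b)^2 = A / 2 and (a + b)^2 = B + A / 2; then
   D = (S - a^2 - b^2) / (2 a b) has norm < 1, so W = D + i sqrt(1 - D^2) is
   unitary and M = a + b W satisfies M^* M = M M^* = S. Put U_i = L_i M^-1 and
   G_i = U_i W, so that L_i = a U_i + b G_i. Parseval's identity for U is
   M^* M = S, and <U_i^* g, U_j^* h> = <L_j S^-1 L_i^* g, h> where the lower
   Riesz bound forces L_j S^-1 L_i^* g = delta_ij g.

   Adjoints of complex-linear maps are determined by the real inner product
   Re <x, y>, which is what the proof works with. *)
Require Import Defs.
From HB Require Import structures.
From mathcomp Require Import all_boot all_order all_algebra sesquilinear finmap.
From mathcomp Require Import complex.
From mathcomp Require Import all_classical all_reals all_analysis.
From mathcomp Require Import ring lra.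
Import numFieldNormedType.Exports.
Import Order.TTheory GRing.Theory Num.Theory.

Set Implicit Arguments.
Unset Strict Implicit.
Unset Printing Implicit Defensive.

Local Open Scope classical_set_scope.
Local Open Scope ring_scope.

(** * The real inner product Re <x, y> and the real-valued norm *)

Lemma ReD (R : realType) (x y : R[i]) :
  complex.Re (x + y) = complex.Re x + complex.Re y.
Proof. by case: x; case: y. Qed.

Section RealInner.
Context {R : realType} {V : hilbertType R}.
Implicit Types (x y z : V) (a b : R) (c d : R[i]).

Definition rinner x y : R := complex.Re (inner x y).

Lemma innerC x y : inner y x = (inner x y)^*%C.
Proof. by rewrite (hermC (@inner R V)) expr0 mul1r. Qed.

Lemma rinnerC x y : rinner x y = rinner y x.
Proof. by rewrite /rinner innerC; case: (inner y x). Qed.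

Lemma rinnerDl x y z : rinner (x + y) z = rinner x z + rinner y z.
Proof. by rewrite /rinner linearDl ReD. Qed.

Lemma rinnerDr x y z : rinner z (x + y) = rinner z x + rinner z y.
Proof. by rewrite !(rinnerC z) rinnerDl. Qed.

Lemma innerZl c x y : inner (c *: x) y = c * inner x y.
Proof. by rewrite linearZl_LR. Qed.

Lemma rinnerZl a x y : rinner (a%:C%C *: x) y = a * rinner x y.
Proof.
by rewrite /rinner innerZl; case: (inner x y) => u v /=; rewrite mul0r subr0.
Qed.

Lemma rinnerZr a x y : rinner x (a%:C%C *: y) = a * rinner x y.
Proof. by rewrite !(rinnerC x) rinnerZl. Qed.

Lemma rinnerZC c x y : rinner (c *: x) y = rinner x (c^*%C *: y).
Proof.
rewrite (rinnerC x) /rinner !innerZl (innerC x y).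
by case: (inner x y) => u v; case: c => a b /=; rewrite mulrNN.
Qed.

Lemma rinnerNl x y : rinner (- x) y = - rinner x y.
Proof.
have : rinner (- x + x) y = 0 by rewrite addNr /rinner linear0l.
by rewrite rinnerDl => /eqP; rewrite addr_eq0 => /eqP.
Qed.

Lemma rinnerNr x y : rinner x (- y) = - rinner x y.
Proof. by rewrite !(rinnerC x) rinnerNl. Qed.

Lemma rinner0l y : rinner 0 y = 0.
Proof. by rewrite /rinner linear0l. Qed.

Lemma rinner0r x : rinner x 0 = 0.
Proof. by rewrite rinnerC rinner0l. Qed.

Definition rinnerE := (rinnerDl, rinnerDr, rinnerNl, rinnerNr, rinnerZl, rinnerZr).

Lemma rinner_sumr (I : Type) (s : seq I) (f : I -> V) x :
  rinner x (\sum_(i <- s) f i) = \sum_(i <- s) rinner x (f i).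
Proof. exact: (big_morph _ (fun y z => rinnerDr y z x) (rinner0r x)). Qed.

Lemma rinner_suml (I : Type) (s : seq I) (f : I -> V) x :
  rinner (\sum_(i <- s) f i) x = \sum_(i <- s) rinner (f i) x.
Proof. by rewrite rinnerC rinner_sumr; apply: eq_bigr => i _; exact: rinnerC. Qed.

End RealInner.

(* Im z = - Re (i z), so an inner product is determined by its real part. *)
Lemma inner_rinner {R : realType} {V W : hilbertType R} (x y : V) (x' y' : W) :
  (forall c : R[i], rinner (c *: x) y = rinner (c *: x') y') ->
  inner x y = inner x' y'.
Proof.
move=> h; have := h 1; have := h 'i%C; rewrite !scale1r /rinner !innerZl.
case: (inner x y) => p q; case: (inner x' y') => r s /=.
by rewrite !mul0r !mul1r !sub0r => /oppr_inj -> ->.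
Qed.

Section RealNorm.
Context {R : realType} {V : normedModType R[i]}.
Implicit Types (x y z : V) (a b : R) (c d : R[i]).

Lemma norm_rnorm x : `|x| = (rnorm x)%:C%C.
Proof. by rewrite /rnorm RRe_real // ger0_real. Qed.

Lemma rnorm_ge0 x : 0 <= rnorm x.
Proof. by rewrite -ler0c -norm_rnorm. Qed.

Lemma rnorm_eq0 x : (rnorm x == 0) = (x == 0).
Proof. by rewrite -(normr_eq0 x) norm_rnorm eq_complex /= eqxx andbT. Qed.

Lemma rnormZ c x : rnorm (c *: x) = complex.Re `|c| * rnorm x.
Proof.
apply: complexI; rewrite -norm_rnorm normrZ norm_rnorm.
by rewrite rmorphM /= RRe_real // ger0_real.
Qed.

Lemma rnormD x y : rnorm (x + y) <= rnorm x + rnorm y.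
Proof. by rewrite -lecR rmorphD /= -!norm_rnorm ler_normD. Qed.

Lemma rnormN x : rnorm (- x) = rnorm x.
Proof. by rewrite /rnorm normrN. Qed.

Lemma rnorm_distC x y : rnorm (x - y) = rnorm (y - x).
Proof. by rewrite -rnormN opprB. Qed.

Lemma rnorm0 : rnorm (0 : V) = 0.
Proof. by apply/eqP; rewrite rnorm_eq0. Qed.

End RealNorm.

Section Hilbert.
Context {R : realType} {V : hilbertType R}.
Implicit Types (x y z : V) (a b : R) (c d : R[i]).

Lemma rinner_sqr x : rinner x x = rnorm x ^+ 2.
Proof. by rewrite /rinner -sqr_normE norm_rnorm -rmorphXn. Qed.

Lemma rinner_inj x y : (forall z, rinner z x = rinner z y) -> x = y.
Proof.
move=> h; apply/eqP; rewrite -subr_eq0 -rnorm_eq0 -sqrf_eq0 -rinner_sqr.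
by rewrite rinnerDr rinnerNr h subrr.
Qed.

Lemma rnormD_sqr x y :
  rnorm (x + y) ^+ 2 = rnorm x ^+ 2 + rnorm y ^+ 2 + 2 * rinner x y.
Proof. by rewrite -!rinner_sqr !rinnerE (rinnerC y x); ring. Qed.

Lemma rinner_le x y : rinner x y <= rnorm x * rnorm y.
Proof.
have [->|x0] := eqVneq x 0; first by rewrite rinner0l rnorm0 mul0r.
have [->|y0] := eqVneq y 0; first by rewrite rinner0r rnorm0 mulr0.
have nx : 0 < rnorm x by rewrite lt_def rnorm_eq0 x0 rnorm_ge0.
have ny : 0 < rnorm y by rewrite lt_def rnorm_eq0 y0 rnorm_ge0.
(* Cauchy-Schwarz: expanding the square of the norm of |y| x - |x| y leaves 2 |x| |y| (|x| |y| - Re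
   <x, y>), and |x| |y| > 0. *)
have := sqr_ge0 (rnorm ((rnorm y)%:C%C *: x - (rnorm x)%:C%C *: y)).
rewrite -rinner_sqr !rinnerE (rinnerC y x) !rinner_sqr => h.
have: 0 <= 2 * (rnorm x * rnorm y) * (rnorm x * rnorm y - rinner x y) by nra.
by rewrite pmulr_rge0 ?subr_ge0// !mulr_gt0.
Qed.

Lemma rinner_abs x y : `|rinner x y| <= rnorm x * rnorm y.
Proof.
rewrite ler_norml rinner_le andbT lerNl -rinnerNl -(rnormN x).
exact: rinner_le.
Qed.

End Hilbert.

(** * Convergent sequences and pointwise limits of linear maps *)

Section Convergence.
Context {R : realType} {V : hilbertType R}.
Implicit Types (x y z : V) (a b : R) (c d : R[i]) (u v : nat -> V).

Lemma gt0_Re c : 0 < c -> 0 < complex.Re c /\ c = (complex.Re c)%:C%C.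
Proof.
by move=> c0; split; [move: c0; rewrite ltcE => /andP[]|rewrite RRe_real ?gtr0_real].
Qed.

Lemma cvg_rnormP u x :
  u @ \oo --> x <-> rnorm (u n - x) @[n --> \oo] --> (0 : R).
Proof.
split=> [/cvgrPdist_lt ux|/cvgrPdist_lt ux]; apply/cvgrPdist_lt => e.
  move=> e0; have e0' : 0 < e%:C%C :> R[i] by rewrite ltcR.
  apply: filterS (ux _ e0') => n; rewrite norm_rnorm ltcR.
  by rewrite sub0r normrN ger0_norm ?rnorm_ge0// rnorm_distC.
move=> /gt0_Re[/ux eu ->]; apply: filterS eu => n.
by rewrite sub0r normrN ger0_norm ?rnorm_ge0// rnorm_distC norm_rnorm ltcR.
Qed.

Lemma cauchy_rnorm_cvg u :
  (forall e : R, 0 < e -> exists N, forall n, (N <= n)%N ->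
    rnorm (u n - u N) < e) -> exists x, u @ \oo --> x.
Proof.
move=> cu.
suff : cauchy (u @ \oo) by move/cauchy_cvgP/cvg_ex.
apply: cauchy_exP => e /gt0_Re[/cu[N uN] ->].
exists (u N); exists N => // n /= Nn.
by rewrite -ball_normE /= norm_rnorm rnorm_distC ltcR uN.
Qed.

Lemma rinner_cvgl u x y :
  u @ \oo --> x -> rinner (u n) y @[n --> \oo] --> rinner x y.
Proof.
move=> /cvg_rnormP ux; apply/subr_cvg0; apply/norm_cvg0P.
apply: (@squeeze_cvgr _ _ _ _ (fun=> 0) (fun n => rnorm (u n - x) * rnorm y)).
- near=> n; rewrite normr_ge0 /= -rinnerNl -rinnerDl; exact: rinner_abs.
- exact: cvg_cst.
- by rewrite -[X in _ --> X](mul0r (rnorm y)); apply: cvgM => //; exact: cvg_cst.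
Unshelve. all: by end_near. Qed.

Lemma geometric_cvg u M k : 0 <= k < 1 ->
  (forall n, rnorm (u n.+1 - u n) <= M * k ^+ n) -> exists x, u @ \oo --> x.
Proof.
move=> /andP[k0 k1] uM; apply: cauchy_rnorm_cvg => e e0.
have k1' : 0 < 1 - k by rewrite subr_gt0.
(* Telescoping: keeping the exact geometric partial sum, with its factor 1 - k^n, makes the
   induction on n close with equality. *)
have um m n : rnorm (u (m + n)%N - u m) <= M * k ^+ m * (1 - k ^+ n) / (1 - k).
  elim: n => [|n ih]; first by rewrite addn0 subrr rnorm0 expr0 subrr mulr0 mul0r.
  have -> : u (m + n.+1)%N - u m = (u (m + n).+1 - u (m + n)%N) + (u (m + n)%N - u m).
    by rewrite addrA subrK addnS.
  apply: le_trans (rnormD _ _) _; apply: le_trans (lerD (uM _) ih) _.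
  rewrite le_eqVlt; apply/orP; left; apply/eqP.
  by rewrite exprD exprS; field; rewrite gt_eqF.
have M0 : 0 <= M.
  by have := le_trans (rnorm_ge0 _) (uM 0%N); rewrite expr0 mulr1.
have : (M / (1 - k)) * k ^+ n @[n --> \oo] --> (M / (1 - k)) * 0.
  by apply: cvgM; [exact: cvg_cst|apply: cvg_expr; rewrite ger0_norm].
rewrite mulr0 => /cvgrPdist_lt/(_ _ e0)[N _ /(_ N (leqnn N))] /= eN.
exists N => n Nn; rewrite -(subnKC Nn); apply: le_lt_trans (um _ _) _.
apply: le_lt_trans eN; rewrite sub0r normrN ger0_norm; last first.
  by rewrite mulr_ge0 ?divr_ge0 ?exprn_ge0// ltW.
rewrite [leRHS]mulrAC ler_pM2r ?invr_gt0//.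
by rewrite ler_piMr ?mulr_ge0 ?exprn_ge0// gerBl exprn_ge0.
Qed.

End Convergence.

Lemma lim_linear {R : realType} {V W : hilbertType R} (T : nat -> V -> W) :
  (forall n, linear (T n)) ->
  (forall x, exists y : W, T n x @[n --> \oo] --> y) ->
  exists S : {linear V -> W}, forall x, T n x @[n --> \oo] --> S x.
Proof.
move=> Tlin /choice[S TS].
have Slin : linear S.
  move=> c x y; apply: (@norm_cvg_unique _ W (T n (c *: x + y) @[n --> \oo])).
    exact: TS.
  - have -> : (fun n => T n (c *: x + y)) = (fun n => c *: T n x + T n y).
      by apply/funext => n; exact: Tlin.
    by apply: cvgD => //; apply: cvgZr.
pose S' := HB.pack_for {linear V -> W} S (GRing.isLinear.Build _ _ _ _ S Slin).
by exists S'.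
Qed.

(** * Bounded linear maps *)

Section BoundedOp.
Context {R : realType} {V W : hilbertType R}.

Lemma rnorm_boundedP (T : {linear V -> W}) :
  bounded_near T (nbhs (0 : V)) <->
  exists2 M : R, 0 <= M & forall x, rnorm (T x) <= M * rnorm x.
Proof.
split=> [/linear_boundedP/pinfty_ex_gt0[M /gt0_Re[M0 ME] TM]|[M M0 TM]].
  exists (complex.Re M); first exact: ltW.
  by move=> x; rewrite -lecR rmorphM /= -!norm_rnorm -ME.
apply/linear_boundedP; exists (M%:C%C); split; first by rewrite ger0_real ?ler0c.
move=> c Mc x; apply: le_trans (_ : M%:C%C * `|x| <= _).
  by rewrite !norm_rnorm -rmorphM lecR.
by rewrite ler_wpM2r// ltW.
Qed.

Lemma bounded_cvg (T : {linear V -> W}) M (u : nat -> V) x : 0 <= M ->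
  (forall x, rnorm (T x) <= M * rnorm x) ->
  u @ \oo --> x -> T (u n) @[n --> \oo] --> T x.
Proof.
move=> M0 TM ux; apply: cvg_comp ux _.
by apply: bounded_linear_continuous; apply/rnorm_boundedP; exists M.
Qed.

End BoundedOp.

(** * Coercive equations and the norm of a symmetric operator *)

Section Operators.
Context {R : realType} {V : hilbertType R}.
Implicit Types (x y z : V) (S T D : {linear V -> V}).

(** Variational argument: a solution z is a minimiser of J x = <T x, x> - 2 phi x. Coercivity bounds
    J below and forces minimising sequences to be Cauchy. It serves twice: with T the identity for
    the Riesz representation theorem, and with T the frame operator for its surjectivity. *)
Lemma coercive_solve T (phi : V -> R) (A c : R) : 0 < A ->
  (forall x y, rinner (T x) y = rinner x (T y)) ->
  (forall x, A * rnorm x ^+ 2 <= rinner (T x) x) ->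
  (forall x y, phi (x + y) = phi x + phi y) ->
  (forall (a : R) x, phi (a%:C%C *: x) = a * phi x) ->
  (forall x, `|phi x| <= c * rnorm x) ->
  exists z, forall x, rinner (T z) x = phi x.
Proof.
move=> A0 Tsym TA phiD phiZ phic.
have phiN x : phi (- x) = - phi x.
  by rewrite -mulN1r -phiZ rmorphN1 scaleN1r.
pose J x := rinner (T x) x - 2 * phi x.
have Jlb x : - (c ^+ 2 / A) <= J x.
  have h1 : phi x <= c * rnorm x by apply: le_trans (phic x); exact: ler_norm.
  (* Completing the square in rnorm x. *)
  have h2 : - (c ^+ 2 / A) = A * rnorm x ^+ 2 - 2 * (c * rnorm x)
      - (A * rnorm x - c) ^+ 2 / A by field; rewrite gt_eqF.
  have h3 : 0 <= (A * rnorm x - c) ^+ 2 / A by rewrite divr_ge0 ?sqr_ge0// ltW.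
  by have := TA x; rewrite /J; lra.
pose m := inf (range J).
have Jinf : has_inf (range J).
  by split; [exists (J 0); exists 0|exists (- (c ^+ 2 / A)) => _ [x _ <-]].
have Jm x : m <= J x by apply: ge_inf; [case: Jinf|exists x].
have /choice[u uJ] : forall n : nat, exists x, J x < m + n.+1%:R^-1.
  move=> n; have n0 : 0 < n.+1%:R^-1 :> R by rewrite invr_gt0 ltr0n.
  by have [_ [x _ <-] ?] := inf_adherent n0 Jinf; exists x.
have JD x y (t : R) : J (x + t%:C%C *: y) =
    J x + 2 * t * (rinner (T x) y - phi y) + t ^+ 2 * rinner (T y) y.
  rewrite /J linearD linearZ !rinnerE phiD phiZ (Tsym y x) (rinnerC y).
  by ring.
(* Parallelogram identity at the midpoint of x and y. There J is at least m, while J (u n) and J (u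
   k) are close to m, so the left-hand side is small and coercivity makes u Cauchy. *)
have Jpar x y : rinner (T (x - y)) (x - y) =
    2 * J x + 2 * J y - 4 * J (x + (2^-1)%:C%C *: (y - x)).
  rewrite JD /J !linearB /= !rinnerE phiD phiN.
  by rewrite (Tsym y x) (rinnerC y); field.
have Juu n k : (k <= n)%N -> A * rnorm (u n - u k) ^+ 2 <= 4 / k.+1%:R.
  move=> kn; apply: le_trans (TA _) _; rewrite Jpar.
  have := uJ n; have := uJ k; have := Jm (u n + (2^-1)%:C%C *: (u k - u n)).
  have : n.+1%:R^-1 <= k.+1%:R^-1 :> R by rewrite lef_pV2 ?posrE ?ltr0n// ler_nat.
  move: (n.+1%:R^-1) (k.+1%:R^-1) (J (u n)) (J (u k)) (J _) => ? ? ? ? ?.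
  by lra.
have [z uz] : exists z, u @ \oo --> z.
  apply: cauchy_rnorm_cvg => e e0.
  have : 0 < A * e ^+ 2 / 4 by rewrite divr_gt0// mulr_gt0// exprn_gt0.
  have /cvgrPdist_lt h := @cvg_harmonic R; move=> /h[k _ /(_ k (leqnn k))] /=.
  rewrite sub0r normrN ger0_norm ?invr_ge0 ?ler0n// => ke.
  exists k => n /Juu nk.
  have : A * rnorm (u n - u k) ^+ 2 < A * e ^+ 2.
    by apply: le_lt_trans nk _; rewrite mulrC -ltr_pdivlMr.
  by rewrite ltr_pM2l// ltr_pXn2r// nnegrE ?rnorm_ge0// ltW.
exists z => x; pose d := rinner (T z) x - phi x.
(* The limit of J (u n + t x) - J (u n) + 1 / (n + 1), which is nonnegative because u n is within 1
   / (n + 1) of the infimum. Symmetry moves T onto the fixed x, so that the pairing with T (u n)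
   converges. *)
have dt (t : R) : 0 <= 2 * t * d + t ^+ 2 * rinner (T x) x.
  have rx : rinner (T (u n)) x @[n --> \oo] --> rinner (T z) x.
    under eq_fun do rewrite Tsym.
    by rewrite Tsym; exact: rinner_cvgl.
  have h : n.+1%:R^-1 + (2 * t * (rinner (T (u n)) x - phi x)
      + t ^+ 2 * rinner (T x) x) @[n --> \oo]
      --> 0 + (2 * t * d + t ^+ 2 * rinner (T x) x).
    apply: cvgD; first exact: cvg_harmonic.
    apply: cvgD; last exact: cvg_cst.
    apply: cvgM; first exact: cvg_cst.
    by apply: cvgB => //; exact: cvg_cst.
  rewrite add0r in h; rewrite -(cvg_lim _ h)//.
  apply: limr_ge; first by apply/cvg_ex; eexists; exact: h.
  by near=> n; have := Jm (u n + t%:C%C *: x); have := uJ n; rewrite JD;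
    move: (n.+1%:R^-1) (J (u n)) (rinner _ _ - _) => ? ? ?; lra.
have Q0 : 0 <= rinner (T x) x.
  by apply: le_trans (TA x); rewrite mulr_ge0 ?exprn_ge0 ?rnorm_ge0 ?ltW.
(* With q = <T x, x> >= 0 this t turns the quadratic into - d^2 (q + 2) / (q + 1)^2, so d = 0; the
   added 1 keeps the denominator positive when x = 0. *)
have := dt (- d / (rinner (T x) x + 1)).
set q := rinner (T x) x in Q0 *.
have -> : 2 * (- d / (q + 1)) * d + (- d / (q + 1)) ^+ 2 * q =
    - (d ^+ 2 * ((q + 2) / (q + 1) ^+ 2)).
  by field; rewrite gt_eqF// ltr_wpDl.
rewrite oppr_ge0 pmulr_lle0; last first.
  by rewrite divr_gt0 ?exprn_gt0// ltr_wpDl.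
rewrite le_eqVlt [_ < 0]ltNge sqr_ge0 orbF sqrf_eq0 subr_eq0.
by move=> /eqP.
Unshelve. all: by end_near. Qed.

(** Polarisation: for w = k x and y = D x, subtracting the form of D at w - y from that at w + y
    gives 4 k |D x|^2. By hypothesis this is at most k (|w + y|^2 + |w - y|^2) = 2 k (k^2 |x|^2 + |D
    x|^2). *)
Lemma numerical_radius_bound D (k : R) : 0 < k ->
  (forall x y, rinner (D x) y = rinner x (D y)) ->
  (forall x, `|rinner (D x) x| <= k * rnorm x ^+ 2) ->
  forall x, rnorm (D x) <= k * rnorm x.
Proof.
move=> k0 Dsym Dk x; pose y := D x; pose w := k%:C%C *: x.
have := Dk (w + y); have := Dk (w - y); rewrite !ler_norml.
rewrite -!rinner_sqr linearB linearD !rinnerE => /andP[h1 _] /andP[_ h2].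
rewrite -(@ler_pXn2r _ 2)// ?nnegrE ?mulr_ge0 ?rnorm_ge0 ?(ltW k0)//.
have DZ : D w = k%:C%C *: D x by rewrite linearZ.
move: h1 h2; rewrite DZ /w /y !rinnerE (rinnerC x (D x)).
rewrite (Dsym (D x) x).
have -> : rinner (D x) (D x) = rnorm (D x) ^+ 2 by rewrite rinner_sqr.
have -> : rinner x x = rnorm x ^+ 2 by rewrite rinner_sqr.
rewrite exprMn => h1 h2.
have : 0 <= k * (k ^+ 2 * rnorm x ^+ 2 - rnorm (D x) ^+ 2) by nra.
by rewrite pmulr_rge0// subr_ge0.
Qed.

End Operators.

(** * Existence and uniqueness of adjoints *)

Section Adjoint.
Context {R : realType} {V W : hilbertType R}.
Implicit Types (T : 'L(V, W)).

(** [adjoint] is a choice from a set, so the point is that this set is inhabited. [coercive_solve]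
    for the identity represents the real functional Re <T x, y>, and complex linearity of T upgrades
    this to the complex inner product. *)
Lemma adjointP T x y : inner (T x) y = inner x (adjoint T y).
Proof.
have [M M0 TM] := (rnorm_boundedP T).1 (op_bounded T).
suff /getPex : exists z, forall x, inner (T x) y = inner x z by apply.
have [z zT] : exists z, forall x, rinner z x = rinner (T x) y.
  apply: (@coercive_solve _ _ idfun (fun x => rinner (T x) y) 1 (M * rnorm y)) => //.
  - by move=> v; rewrite mul1r rinner_sqr.
  - by move=> v w; rewrite linearD rinnerDl.
  - by move=> a v; rewrite linearZ rinnerZl.
  - move=> v; apply: le_trans (rinner_abs _ _) _.
    by rewrite mulrAC ler_wpM2r ?rnorm_ge0.
by exists z => v; apply: inner_rinner => c; rewrite -linearZ /= -zT rinnerC.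
Qed.

Lemma rinner_adjoint T x y : rinner (T x) y = rinner x (adjoint T y).
Proof. by rewrite /rinner adjointP. Qed.

Lemma rinnerZ_adjoint T (c : R[i]) x y :
  rinner (c *: T x) y = rinner x (c^*%C *: adjoint T y).
Proof. by rewrite -linearZ rinner_adjoint rinnerZC. Qed.

Lemma adjoint_uniq T y z : (forall x, rinner (T x) y = rinner x z) ->
  adjoint T y = z.
Proof. by move=> h; apply: rinner_inj => x; rewrite -rinner_adjoint. Qed.

Lemma adjoint_linear T : linear (adjoint T).
Proof.
move=> c x y; apply: adjoint_uniq => v.
rewrite !rinnerDr (rinner_adjoint T v y); congr (_ + _).
rewrite rinnerC rinnerZC (rinnerC x) -[c]conjcK -!(rinnerZC _ v) conjcK.
by rewrite -rinner_adjoint linearZ.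
Qed.

End Adjoint.

(** * The square root of 1 - D^2 and the factorization of S through a unitary *)

Section Factorization.
Context {R : realType} {V : hilbertType R}.
Implicit Types (x y z : V) (S T D Q : {linear V -> V}).

(* The iterates converge to 1 - sqrt(1 - D^2), the solution of
   Y = (D^2 + Y^2) / 2. *)
Fixpoint sqrt_iter D (n : nat) : {linear V -> V} :=
  if n is n'.+1 then
    (2^-1 : R[i]) \*: ((D \o D) \+ (sqrt_iter D n' \o sqrt_iter D n'))
  else \0.

Lemma sqrt_iterS D n x : sqrt_iter D n.+1 x =
  (2^-1)%:C%C *: (D (D x) + sqrt_iter D n (sqrt_iter D n x)).
Proof. by rewrite /= fmorphV rmorphD. Qed.

Lemma sqrt_iter_sym D n : (forall x y, rinner (D x) y = rinner x (D y)) ->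
  forall x y, rinner (sqrt_iter D n x) y = rinner x (sqrt_iter D n y).
Proof.
move=> Dsym; elim: n => [|n ih] x y; first by rewrite /= rinner0l rinner0r.
by rewrite !sqrt_iterS !rinnerE !Dsym !ih.
Qed.

(** The iterates are polynomials in D. Applied with T = D, and with T another iterate. *)
Lemma sqrt_iter_comm D T n : (forall x, T (D x) = D (T x)) ->
  forall x, T (sqrt_iter D n x) = sqrt_iter D n (T x).
Proof.
move=> TD; elim: n => [|n ih] x; first by rewrite /= linear0.
by rewrite !sqrt_iterS linearZ linearD /= !TD !ih.
Qed.

Section Contraction.
Variables (D : {linear V -> V}) (k : R).
Hypotheses (k0 : 0 <= k) (k1 : k < 1).
Hypothesis Dsym : forall x y, rinner (D x) y = rinner x (D y).
Hypothesis Dk : forall x, rnorm (D x) <= k * rnorm x.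
Let Y := sqrt_iter D.

Lemma rnorm_half x : rnorm ((2^-1)%:C%C *: x) = 2^-1 * rnorm x.
Proof.
by rewrite rnormZ ger0_norm ?ler0c ?invr_ge0.
Qed.

Lemma sqrt_iter_le n x : rnorm (Y n x) <= k * rnorm x.
Proof.
elim: n x => [|n ih] x; first by rewrite /= rnorm0 mulr_ge0 ?rnorm_ge0.
rewrite /Y sqrt_iterS rnorm_half.
have h : rnorm (D (D x)) <= k * rnorm x.
  apply: le_trans (Dk _) _; rewrite ler_wpM2l//; apply: le_trans (Dk _) _.
  by rewrite ler_piMl ?rnorm_ge0 ?(ltW k1).
have h' : rnorm (Y n (Y n x)) <= k * rnorm x.
  apply: le_trans (ih _) _; rewrite ler_wpM2l//; apply: le_trans (ih _) _.
  by rewrite ler_piMl ?rnorm_ge0 ?(ltW k1).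
by have := rnormD (D (D x)) (Y n (Y n x)); rewrite -/Y; lra.
Qed.

(** Commuting iterates give Y_(n+2) - Y_(n+1) = (Y_(n+1) + Y_n) (Y_(n+1) - Y_n) / 2, and each of
    Y_(n+1), Y_n has norm at most k. *)
Lemma sqrt_iter_step n x : rnorm (Y n.+1 x - Y n x) <= rnorm x * k ^+ n.
Proof.
elim: n x => [|n ih] x.
  rewrite expr0 mulr1 subr0; apply: le_trans (sqrt_iter_le _ _) _.
  by rewrite ler_piMl ?rnorm_ge0 ?(ltW k1).
have -> : Y n.+2 x - Y n.+1 x =
    (2^-1)%:C%C *: (Y n.+1 (Y n.+1 x - Y n x) + Y n (Y n.+1 x - Y n x)).
  have YY : Y n.+1 (Y n x) = Y n (Y n.+1 x).
    by apply: sqrt_iter_comm => z; rewrite -sqrt_iter_comm.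
  rewrite /Y sqrt_iterS [X in _ - X]sqrt_iterS -scalerBr -/Y; congr (_ *: _).
  by rewrite opprD addrACA subrr add0r !(linearB (Y _)) YY addrA subrK.
rewrite rnorm_half.
have := rnormD (Y n.+1 (Y n.+1 x - Y n x)) (Y n (Y n.+1 x - Y n x)).
have := sqrt_iter_le n.+1 (Y n.+1 x - Y n x).
have := sqrt_iter_le n (Y n.+1 x - Y n x).
have : k * rnorm (Y n.+1 x - Y n x) <= rnorm x * k ^+ n.+1.
  by rewrite exprS mulrCA ler_wpM2l.
by lra.
Qed.

Lemma sqrt_one_sub_sqr : exists Q,
  [/\ forall x y, rinner (Q x) y = rinner x (Q y),
      forall x, Q (D x) = D (Q x) & forall x, Q (Q x) = x - D (D x)].
Proof.
have [Z YZ] : exists Z : {linear V -> V}, forall x, Y n x @[n --> \oo] --> Z x.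
  apply: lim_linear => [n|x]; first exact: linearP.
  apply: (@geometric_cvg _ _ _ (rnorm x) k).
    by rewrite k0 k1.
  by move=> n; exact: sqrt_iter_step.
have Zsym x y : rinner (Z x) y = rinner x (Z y).
  have hx := @rinner_cvgl _ _ _ _ y (YZ x).
  have hy := @rinner_cvgl _ _ _ _ x (YZ y).
  rewrite [RHS]rinnerC; apply: norm_cvg_unique hx _.
  suff -> : (fun n => rinner (Y n x) y) = (fun n => rinner (Y n y) x) by [].
  by apply/funext => n; rewrite sqrt_iter_sym// rinnerC.
have ZD x : Z (D x) = D (Z x).
  apply: (@norm_cvg_unique _ V (Y n (D x) @[n --> \oo])); first exact: YZ.
  have := bounded_cvg k0 Dk (YZ x).
  suff -> : (fun n => D (Y n x)) = (fun n => Y n (D x)) by [].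
  by apply/funext => n; rewrite sqrt_iter_comm.
(* The uniform bound k on the iterates takes care of Y_n applied to the vanishing difference Y_n x -
   Z x. *)
have YY x : Y n (Y n x) @[n --> \oo] --> Z (Z x).
  have -> : (fun n => Y n (Y n x)) = (fun n => Y n (Y n x - Z x) + Y n (Z x)).
    by apply/funext => n; rewrite linearB subrK.
  rewrite -[Z (Z x)]add0r; apply: cvgD; last exact: YZ.
  apply/cvg_rnormP; under eq_fun do rewrite subr0.
  have /cvg_rnormP := YZ x => h.
  apply: (@squeeze_cvgr _ _ _ _ (fun=> 0) (fun n => k * rnorm (Y n x - Z x))).
  - by near=> n; rewrite rnorm_ge0 /= sqrt_iter_le.
  - exact: cvg_cst.
  - by rewrite -(mulr0 k); apply: cvgM => //; exact: cvg_cst.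
have ZE x : Z x + Z x = D (D x) + Z (Z x).
  have h2 : Y n.+1 x @[n --> \oo] --> Z x.
    by have := YZ x; rewrite -cvg_shiftS.
  have h3 : Y n.+1 x @[n --> \oo] --> (2^-1)%:C%C *: (D (D x) + Z (Z x)).
    rewrite (_ : (fun n => Y n.+1 x) =
        (fun n => (2^-1)%:C%C *: (D (D x) + Y n (Y n x)))); last first.
      by apply/funext => n; exact: sqrt_iterS.
    by apply: cvgZl_tmp; apply: cvgD; [exact: cvg_cst|exact: YY].
  rewrite [in LHS](norm_cvg_unique h2 h3) -scalerDl -rmorphD /=.
  by rewrite (_ : 2^-1 + 2^-1 = 1 :> R) ?scale1r//; field.
(* For Q = 1 - Z, Q^2 = 1 - 2 Z + Z^2 = 1 - D^2 by the fixed-point equation [ZE]. *)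
exists (idfun \- Z : {linear V -> V}); split => [x y|x|x] /=.
- by rewrite !rinnerE Zsym.
- by rewrite linearB /= ZD.
- have -> : D (D x) = Z x + Z x - Z (Z x) by rewrite ZE addrK.
  by rewrite linearB /= !opprD !opprK !addrA.
Unshelve. all: by end_near. Qed.

End Contraction.

(** As W and W' are mutually inverse, the right-hand side is the expansion of (a + b W') (a + b W),
    a product of an operator with its adjoint. *)
Lemma abs_sqr_factor S (A B : R) : 0 < A -> A <= B ->
  (forall x y, rinner (S x) y = rinner x (S y)) ->
  (forall x, A * rnorm x ^+ 2 <= rinner (S x) x <= B * rnorm x ^+ 2) ->
  exists (W W' : {linear V -> V}) (a b : R),
    [/\ forall x y, rinner (W x) y = rinner x (W' y),
        cancel W W', cancel W' W &
        forall x, S x = ((a ^+ 2 + b ^+ 2)%:C%C *: x) + (a * b)%:C%C *: (W x + W' x)].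
Proof.
move=> A0 AB Ssym SAB; have B0 : 0 < B := lt_le_trans A0 AB.
(* This is (S - a^2 - b^2) / (2 a b) for the a, b chosen below, where a^2 + b^2 = (A + B) / 2 and a
   b = B / 4. *)
pose D : {linear V -> V} := (B^-1)%:C%C \*:
  ((2%:C%C \*: S) \- ((A + B)%:C%C \*: idfun)).
have DE x : D x = (B^-1)%:C%C *: (2%:C%C *: S x - (A + B)%:C%C *: x) by [].
(* The form of D is even bounded by 1 - A / B, but that vanishes when A = B and
   [numerical_radius_bound] asks for k > 0. *)
pose k := 1 - A / (2 * B).
have k0 : 0 < k by rewrite subr_gt0 ltr_pdivrMr ?mulr_gt0//; lra.
have k1 : k < 1 by rewrite gtrBl divr_gt0// mulr_gt0.
have Dsym x y : rinner (D x) y = rinner x (D y).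
  by rewrite !DE !rinnerE Ssym.
have Dk : forall x, rnorm (D x) <= k * rnorm x.
  apply: numerical_radius_bound => // x; rewrite DE !rinnerE rinner_sqr.
  have /andP[] := SAB x; move: (rinner (S x) x) (sqr_ge0 (rnorm x)) => s.
  move: (rnorm x ^+ 2) => n n0 h1 h2.
  rewrite normrM gtr0_norm ?invr_gt0// -ler_pdivlMl ?invr_gt0// invrK.
  rewrite (_ : B * (k * n) = (B - A / 2) * n); last first.
    by rewrite /k; field; rewrite gt_eqF.
  by rewrite ler_norml; apply/andP; split; nra.
have [Q [Qsym QD QQ]] := sqrt_one_sub_sqr (ltW k0) k1 Dsym Dk.
(* D and Q act as cosine and sine: they commute and D^2 + Q^2 = 1, so W and W' are inverse; they are
   symmetric, so W' is the adjoint of W. *)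
pose W : {linear V -> V} := D \+ ('i%C : R[i]) \*: Q.
pose W' : {linear V -> V} := D \- ('i%C : R[i]) \*: Q.
have DW x : W x = D x + 'i%C *: Q x by [].
have DW' x : W' x = D x - 'i%C *: Q x by [].
have ii : 'i%C * 'i%C = -1 :> R[i] by rewrite -expr2 sqr_i.
have linI (T : {linear V -> V}) x y : T (x + 'i%C *: y) = T x + 'i%C *: T y.
  by rewrite linearD linearZ.
have linIB (T : {linear V -> V}) x y : T (x - 'i%C *: y) = T x - 'i%C *: T y.
  by rewrite linearB linearZ.
have p0 : 0 <= A / 2 by rewrite divr_ge0// ltW.
have q0 : 0 <= B + A / 2 by rewrite addr_ge0// ltW.
exists W, W', ((Num.sqrt (B + A / 2) + Num.sqrt (A / 2)) / 2),
  ((Num.sqrt (B + A / 2) - Num.sqrt (A / 2)) / 2); split.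
- move=> x y; rewrite DW DW' !rinnerDl rinnerDr rinnerNr Dsym rinnerZC Qsym.
  congr (_ + _); rewrite linearZ /= -rinnerNr -scaleNr; congr (rinner x (_ *: _)).
  by apply/eqP; rewrite eq_complex /= oppr0 !eqxx.
- move=> x; rewrite DW' DW (linI D) (linI Q) !QD scalerDr (scalerA 'i%C 'i%C) ii scaleN1r QQ.
  by rewrite opprB addrACA subrr addr0 addrC subrK.
- move=> x; rewrite DW DW' (linIB D) (linIB Q) !QD scalerBr (scalerA 'i%C 'i%C) ii scaleN1r QQ.
  by rewrite opprK addrA subrK addrC subrK.
move=> x; rewrite DW DW' addrACA subrr addr0 DE -scalerDl.
have := sqr_sqrtr p0; have := sqr_sqrtr q0.
move: (Num.sqrt (B + A / 2)) (Num.sqrt (A / 2)) => q p qE pE.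
rewrite (_ : ((q + p) / 2) ^+ 2 + ((q - p) / 2) ^+ 2 = (A + B) / 2); last first.
  by rewrite (_ : A + B = q ^+ 2 + p ^+ 2); [field|rewrite qE pE; field].
rewrite (_ : (q + p) / 2 * ((q - p) / 2) = B / 4); last first.
  by rewrite (_ : B = q ^+ 2 - p ^+ 2); [field|rewrite qE pE; ring].
rewrite -rmorphD /= !scalerA -!rmorphM /= scalerBr !scalerA -!rmorphM /=.
rewrite addrCA -scalerBl -rmorphB /=.
rewrite (_ : _ * _ * 2 = 1); last by field; rewrite gt_eqF.
rewrite (_ : _ - _ = 0) ?scale1r ?scale0r ?addr0//.
by field; rewrite gt_eqF.
Qed.

End Factorization.

(** * Sums over a countable type as limits along finite sets *)

Section Exhaustion.
Context {T : countType}.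
Implicit Types (I : {fset T}).

(** The elements whose code is below n. One increasing sequence of finite sets serves both the
    extended-real sums and the vector sums. *)
Definition exhaust (n : nat) : {fset T} :=
  [fset x in pmap (@pickle_inv T) (iota 0 n)]%fset.

Lemma in_exhaust n x : (x \in exhaust n) = (choice.pickle x < n)%N.
Proof.
rewrite inE mem_pmap; apply/mapP/idP => [[k]|xn].
  rewrite mem_iota add0n => /andP[_ kn] /esym kx.
  by have := @pickle_invK T k; rewrite kx /= => ->.
by exists (choice.pickle x); rewrite ?mem_iota ?pickleK_inv.
Qed.

Lemma exhaust_subset n m : (n <= m)%N -> (exhaust n `<=` exhaust m)%fset.
Proof.
by move=> nm; apply/fsubsetP => x; rewrite !in_exhaust => /leq_trans; exact.
Qed.

Lemma near_exhaust I : \forall n \near \oo, (I `<=` exhaust n)%fset.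
Proof.
exists (\max_(x <- I) (choice.pickle x).+1)%N => // n /= In.
apply/fsubsetP => x xI; rewrite in_exhaust; apply: leq_trans In.
by rewrite (big_fsetD1 x)//= leq_maxl.
Qed.

Lemma big_fset_subset (M : zmodType) I I' (F : T -> M) : (I `<=` I')%fset ->
  \sum_(i <- I') F i = \sum_(i <- I) F i + \sum_(i <- (I' `\` I)%fset) F i.
Proof.
move=> /fsubsetP II'; rewrite (big_fsetID _ (mem I)) /=; congr (_ + _).
  congr (\sum_(i <- enum_fset _) _); apply/fsetP => x; rewrite !inE /=.
  by case: (boolP (x \in I)) => [/II' ->|]; rewrite ?andbF.
by congr (\sum_(i <- enum_fset _) _); apply/fsetP => x; rewrite !inE andbC.
Qed.

Context {R : realType} (f : T -> R) (f0 : forall i, 0 <= f i).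

Lemma sum_fset_ge0 I : 0 <= \sum_(i <- I) f i.
Proof. by apply: sumr_ge0 => i _. Qed.

Lemma ler_sum_fset I I' : (I `<=` I')%fset ->
  \sum_(i <- I) f i <= \sum_(i <- I') f i.
Proof. by move=> /big_fset_subset ->; rewrite lerDl sum_fset_ge0. Qed.

(** [esum] is a supremum over finite subsets, and the sets [exhaust n] are cofinal among these. *)
Lemma cvg_exhaust_esum :
  (\sum_(i <- exhaust n) f i)%:E @[n --> \oo] --> (\esum_(i in [set: T]) (f i)%:E)%E.
Proof.
have -> : (\esum_(i in [set: T]) (f i)%:E)%E =
    ereal_sup (range (fun n => (\sum_(i <- exhaust n) f i)%:E)).
  apply/le_anti/andP; split; apply: ge_ereal_sup => y [].
  - move=> A [finA _] <-; have [n _ /(_ n (leqnn n)) An] := near_exhaust (fset_set A).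
    apply: (@le_trans _ _ (\sum_(i <- exhaust n) f i)%:E); last first.
      by apply: ereal_sup_ubound; exists n.
    by rewrite fsbig_finite// sumEFin lee_fin ler_sum_fset.
  - move=> n _ <-; apply: ereal_sup_ubound; exists [set` exhaust n].
      by split=> //; exact: finite_fset.
    by rewrite fsbig_finite ?set_fsetK ?sumEFin//; exact: finite_fset.
apply: ereal_nondecreasing_cvgn => n m nm.
by rewrite lee_fin ler_sum_fset// exhaust_subset.
Qed.

Lemma esum_exhaustP (s : R) :
  (\esum_(i in [set: T]) (f i)%:E = s%:E)%E <->
  \sum_(i <- exhaust n) f i @[n --> \oo] --> s.
Proof.
split=> h; first by have := cvg_exhaust_esum; rewrite h => /fine_cvg.
apply: (cvg_unique (@ereal_hausdorff R) cvg_exhaust_esum).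
by apply: cvg_EFin => //; near=> n.
Unshelve. all: by end_near. Qed.

Lemma ler_sum_exhaust n (s : R) :
  \sum_(i <- exhaust n) f i @[n --> \oo] --> s -> \sum_(i <- exhaust n) f i <= s.
Proof.
move=> h; rewrite -(cvg_lim _ h)//; apply: limr_ge.
  by apply/cvg_ex; exists s.
by exists n => // m /= nm; apply: ler_sum_fset; exact: exhaust_subset.
Qed.

End Exhaustion.

(** * Synthesis through g-orthonormal bases *)

Section OrthonormalBases.
Context {R : realType} {J : set int} {H : hilbertType R} {Hs : J -> hilbertType R}.
Implicit Types (L U G : forall i : J, 'L(H, Hs i)) (I : {fset J})
  (g : forall i : J, Hs i).

(** Orthonormality says that U_j composed with the adjoint of U_i is delta_ij; here it is tested
    against every z. *)
Lemma onb_coord U I g : g_orthonormal_basis U ->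
  forall j, U j (\sum_(i <- I) adjoint (U i) (g i)) = if j \in I then g j else 0.
Proof.
move=> [Uin Uij _] j; apply: rinner_inj => z.
rewrite rinnerC rinner_adjoint rinner_suml.
case: ifP => jI.
  rewrite (big_fsetD1 j)//= [X in X + _]/rinner Uin.
  rewrite big_seq_cond big1 ?addr0 => [|i]; first exact: rinnerC.
  by rewrite andbT !inE => /andP[ij _]; rewrite /rinner Uij.
rewrite rinner0r big_seq_cond big1// => i; rewrite andbT => iI.
by rewrite /rinner Uij//; apply: contraFneq jI => <-.
Qed.

Lemma onb_synthesis U I g : g_orthonormal_basis U ->
  rnorm (\sum_(i <- I) adjoint (U i) (g i)) ^+ 2 = \sum_(i <- I) rnorm (g i) ^+ 2.
Proof.
move=> oU; set x := \sum_(i <- I) _.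
rewrite -rinner_sqr {2}/x rinner_sumr; apply: eq_big_seq => i iI.
by rewrite -rinner_adjoint onb_coord// iI rinner_sqr.
Qed.

(* A combination of two unitaries is normal, so the synthesis operator of L has
   the norm of the analysis operator, up to identifying the sequence space with
   H through U. *)
Lemma onb_comb_synthesis L U G (a b : R[i]) I g :
  g_orthonormal_basis U -> g_orthonormal_basis G ->
  (forall i f, L i f = a *: U i f + b *: G i f) ->
  (\esum_(i in [set: J]) (rnorm (L i (\sum_(i <- I) adjoint (U i) (g i))) ^+ 2)%:E)%E
    = (rnorm (\sum_(i <- I) adjoint (L i) (g i)) ^+ 2)%:E.
Proof.
move=> oU oG LE.
pose x := \sum_(i <- I) adjoint (U i) (g i).
pose y := \sum_(i <- I) adjoint (G i) (g i).
have Lxy : \sum_(i <- I) adjoint (L i) (g i) = a^*%C *: x + b^*%C *: y.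
  rewrite !scaler_sumr -big_split /=; apply: eq_bigr => i _.
  apply: adjoint_uniq => f; rewrite LE rinnerDl rinnerDr.
  by rewrite !rinnerZ_adjoint.
have normZ2 (V : hilbertType R) (c : R[i]) (v : V) :
    rnorm (c *: v) ^+ 2 = complex.Re `|c| ^+ 2 * rnorm v ^+ 2.
  by rewrite rnormZ exprMn.
apply/esum_exhaustP => [i|]; first exact: sqr_ge0.
(* The norm of x stands in both squares since x and y both have squared norm equal to the sum of the
   rnorm (g i) ^+ 2. *)
have -> : rnorm (\sum_(i <- I) adjoint (L i) (g i)) ^+ 2 =
    complex.Re `|a| ^+ 2 * rnorm x ^+ 2 + complex.Re `|b| ^+ 2 * rnorm x ^+ 2
    + 2 * rinner x ((a * b^*%C) *: y).
  rewrite Lxy rnormD_sqr !normZ2 !normcJ onb_synthesis// onb_synthesis//.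
  by rewrite rinnerZC conjcK scalerA.
have [_ _ /(_ x)/esum_exhaustP Ux] := oU.
have [_ _ /(_ x)/esum_exhaustP Gx] := oG.
pose S n := complex.Re `|a| ^+ 2 * (\sum_(i <- exhaust n) rnorm (U i x) ^+ 2)
  + complex.Re `|b| ^+ 2 * (\sum_(i <- exhaust n) rnorm (G i x) ^+ 2)
  + 2 * rinner x ((a * b^*%C) *: y).
apply: (@cvg_trans _ (S n @[n --> \oo])); last first.
  apply: cvgD; last exact: cvg_cst.
  apply: cvgD; apply: cvgM; try exact: cvg_cst.
    by apply: Ux => i; exact: sqr_ge0.
  by apply: Gx => i; exact: sqr_ge0.
apply: near_eq_cvg; near=> n.
have In : (I `<=` exhaust n)%fset by near: n; exact: near_exhaust.
(* U_i x is g_i on I and 0 elsewhere, so the cross terms of the |L_i x|^2 add up to a finite sum,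
   constant once [exhaust n] contains I; moving G_i to its adjoint identifies it. *)
rewrite /S; have -> : 2 * rinner x ((a * b^*%C) *: y) =
    \sum_(i <- exhaust n) 2 * rinner (a *: U i x) (b *: G i x).
  rewrite scaler_sumr rinner_sumr mulr_sumr.
  rewrite -(big_fset_incl _ In) => [|i _ iI]; last first.
    by rewrite onb_coord// (negbTE iI) scaler0 rinner0l mulr0.
  apply: eq_big_seq => i iI; rewrite onb_coord// iI; congr (_ * _).
  rewrite [RHS]rinnerC -[in RHS](conjcK a) -[RHS]rinnerZC scalerA.
  by rewrite [RHS]rinnerZ_adjoint rmorphM /= conjcK.
rewrite !mulr_sumr -!big_split /=.
by apply: eq_bigr => i _; rewrite LE rnormD_sqr !normZ2.
Unshelve. all: by end_near. Qed.


End OrthonormalBases.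

(** * Bounded inverses and composition with bounded operators *)

Section BoundedInverse.
Context {R : realType} {V W : hilbertType R}.

Lemma bounded_below_inverse (T : {linear V -> V}) (c : R) : 0 < c ->
  (forall x, c * rnorm x ^+ 2 <= rnorm (T x) ^+ 2) ->
  (forall y, exists x, T x = y) ->
  exists N : {linear V -> V},
    [/\ bounded_near N (nbhs (0 : V)), cancel T N & cancel N T].
Proof.
move=> c0 Tc /choice[N NT].
have TN : cancel T N.
  move=> x; apply/eqP; rewrite -subr_eq0 -rnorm_eq0 -sqrf_eq0.
  rewrite eq_le sqr_ge0 andbT -(ler_pM2l c0) mulr0.
  by apply: le_trans (Tc _) _; rewrite linearB NT subrr rnorm0 expr0n.
pose N' := HB.pack_for {linear V -> V} N
  (GRing.isLinear.Build _ _ _ _ N (can2_linear TN NT)).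
exists N'; split => //; apply/rnorm_boundedP; exists (Num.sqrt c^-1) => [|x].
  exact: sqrtr_ge0.
have ci : 0 <= c^-1 by rewrite invr_ge0 ltW.
rewrite -(@ler_pXn2r _ 2)// ?nnegrE ?mulr_ge0 ?rnorm_ge0 ?sqrtr_ge0//.
rewrite exprMn sqr_sqrtr// -(ler_pM2l c0) [leRHS]mulrA divff ?gt_eqF// mul1r.
by apply: le_trans (Tc _) _; rewrite NT.
Qed.

Lemma bounded_near_comp (T : 'L(V, W)) (N : {linear V -> V}) :
  bounded_near N (nbhs (0 : V)) ->
  bounded_near (op_linear T \o N : {linear V -> W}) (nbhs (0 : V)).
Proof.
move=> /rnorm_boundedP[M M0 NM].
have [K K0 TK] := (rnorm_boundedP T).1 (op_bounded T).
apply/rnorm_boundedP; exists (K * M) => [|x]; first exact: mulr_ge0.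
by apply: le_trans (TK _) _; rewrite -mulrA ler_wpM2l.
Qed.

Definition comp_op (T : 'L(V, W)) (N : {linear V -> V})
    (hN : bounded_near N (nbhs (0 : V))) : 'L(V, W) :=
  BoundedOp (bounded_near_comp T hN).

Lemma adjoint_comp_op T (N : {linear V -> V}) hN (N' : V -> V) y :
  (forall x z, rinner (N x) z = rinner x (N' z)) ->
  adjoint (@comp_op T N hN) y = N' (adjoint T y).
Proof. by move=> NN'; apply: adjoint_uniq => x; rewrite -NN' -rinner_adjoint. Qed.

End BoundedInverse.

(** * The frame operator and biorthogonality *)

Section GRiesz.
Context {R : realType} {J : set int} {H : hilbertType R} {Hs : J -> hilbertType R}.
Implicit Types (L U : forall i : J, 'L(H, Hs i)).

Lemma esum_rnorm_fin L (B : R) f :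
  (\esum_(i in [set: J]) (rnorm (L i f) ^+ 2)%:E <= (B * rnorm f ^+ 2)%:E)%E ->
  exists s : R, (\esum_(i in [set: J]) (rnorm (L i f) ^+ 2)%:E = s%:E)%E.
Proof.
move=> h; exists (fine (\esum_(i in [set: J]) (rnorm (L i f) ^+ 2)%:E)).
rewrite fineK// ge0_fin_numE ?(le_lt_trans h) ?ltry//.
by apply: esum_ge0 => i _; rewrite lee_fin sqr_ge0.
Qed.

(** The upper Riesz bound applied to the family L_i f controls blocks of the vector series by blocks
    of the convergent series of |L_i f|^2: a block below e^2 / B yields a vector of norm below e. *)
Lemma frame_operator_exists L (B : R) : 0 < B ->
  (forall f, exists s : R,
    (\esum_(i in [set: J]) (rnorm (L i f) ^+ 2)%:E = s%:E)%E) ->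
  (forall (I : {fset J}) (g : forall i : J, Hs i),
    rnorm (\sum_(i <- I) adjoint (L i) (g i)) ^+ 2
      <= B * (\sum_(i <- I) rnorm (g i) ^+ 2)) ->
  exists S : {linear H -> H},
    forall f, \sum_(i <- exhaust n) adjoint (L i) (L i f) @[n --> \oo] --> S f.
Proof.
move=> B0 Lfin LB; apply: lim_linear => [n c x y|f].
  rewrite scaler_sumr -big_split /=; apply: eq_bigr => i _.
  by rewrite linearP adjoint_linear.
have f0 i : 0 <= rnorm (L i f) ^+ 2 by exact: sqr_ge0.
have [s /(esum_exhaustP f0) fs] := Lfin f.
apply: cauchy_rnorm_cvg => e e0.
have e1 : 0 < e ^+ 2 / B by rewrite divr_gt0// exprn_gt0.
have /cvgrPdist_lt/(_ _ e1)[N _ sN] := fs; move: (sN N (leqnn N)) => /= {}sN.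
exists N => n Nn.
rewrite (big_fset_subset _ (exhaust_subset Nn)) addrAC subrr add0r.
rewrite -(@ltr_pXn2r _ 2)// ?nnegrE ?rnorm_ge0 ?(ltW e0)//.
apply: le_lt_trans (LB _ (fun i => L i f)) _; rewrite mulrC -ltr_pdivlMr//.
apply: le_lt_trans sN; apply: le_trans (ler_norm _).
rewrite lerBrDl -(big_fset_subset _ (exhaust_subset Nn)).
exact: ler_sum_exhaust.
Qed.

Lemma frame_operator_sym L (S : {linear H -> H}) :
  (forall f, \sum_(i <- exhaust n) adjoint (L i) (L i f) @[n --> \oo] --> S f) ->
  forall x y, rinner (S x) y = rinner x (S y).
Proof.
move=> LS x y; have hx := @rinner_cvgl _ _ _ _ y (LS x).
have hy := @rinner_cvgl _ _ _ _ x (LS y).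
rewrite [RHS]rinnerC; apply: norm_cvg_unique hx _.
suff -> : (fun n => rinner (\sum_(i <- exhaust n) adjoint (L i) (L i x)) y) =
  (fun n => rinner (\sum_(i <- exhaust n) adjoint (L i) (L i y)) x) by [].
apply/funext => n; rewrite !rinner_suml; apply: eq_bigr => i _.
by rewrite rinnerC -rinner_adjoint rinnerC rinner_adjoint rinnerC.
Qed.

Lemma frame_operator_esum L (S : {linear H -> H}) :
  (forall f, \sum_(i <- exhaust n) adjoint (L i) (L i f) @[n --> \oo] --> S f) ->
  forall f, (\esum_(i in [set: J]) (rnorm (L i f) ^+ 2)%:E
    = (rinner (S f) f)%:E)%E.
Proof.
move=> LS f; apply/esum_exhaustP => [i|]; first exact: sqr_ge0.
have := @rinner_cvgl _ _ _ _ f (LS f).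
suff -> : (fun n => rinner (\sum_(i <- exhaust n) adjoint (L i) (L i f)) f) =
  (fun n => \sum_(i <- exhaust n) rnorm (L i f) ^+ 2) by [].
apply/funext => n; rewrite rinner_suml; apply: eq_bigr => i _.
by rewrite rinnerC -rinner_adjoint rinner_sqr.
Qed.

(** The family (L_k x) and the family with g at i and 0 elsewhere, written with [dfwith], both
    synthesise to S x. The lower Riesz bound makes synthesis injective, so they agree. *)
Lemma Riesz_biorthogonal L (S : {linear H -> H}) (A : R) : 0 < A ->
  (forall f, \sum_(i <- exhaust n) adjoint (L i) (L i f) @[n --> \oo] --> S f) ->
  (forall (I : {fset J}) (g : forall i : J, Hs i),
    A * (\sum_(i <- I) rnorm (g i) ^+ 2)
      <= rnorm (\sum_(i <- I) adjoint (L i) (g i)) ^+ 2) ->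
  forall (i : J) (g : Hs i) x, S x = adjoint (L i) g ->
    forall j, L j x = dfwith (fun k => 0 : Hs k) i g j.
Proof.
move=> A0 LS LA i g x Sx j; pose d := dfwith (fun k => 0 : Hs k) i g.
have adj0 k : adjoint (L k) 0 = 0.
  by apply: adjoint_uniq => z; rewrite !rinner0r.
pose r n := rnorm (\sum_(k <- exhaust n) adjoint (L k) (L k x) - S x).
have r0 : r n ^+ 2 @[n --> \oo] --> (0 : R).
  have /cvg_rnormP h := LS x.
  by rewrite -[X in _ --> X](mulr0 0); under eq_fun do rewrite expr2; exact: cvgM.
have le_r : \forall n \near \oo, A * rnorm (L j x - d j) ^+ 2 <= r n ^+ 2.
  near=> n.
  (* Index i makes the partial synthesis of d equal to [adjoint (L i) g]; index j puts the wanted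
     term into the sum bounded by [LA]. *)
  have ijn : ([fset i; j] `<=` exhaust n)%fset by near: n; exact: near_exhaust.
  have iN : i \in exhaust n by apply: (fsubsetP ijn); rewrite !inE eqxx.
  have jN : j \in exhaust n by apply: (fsubsetP ijn); rewrite !inE eqxx orbT.
  have -> : r n = rnorm (\sum_(k <- exhaust n) adjoint (L k) (L k x - d k)).
    rewrite /r Sx; congr (rnorm _).
    have -> : adjoint (L i) g = \sum_(k <- exhaust n) adjoint (L k) (d k).
      rewrite (big_fsetD1 i)//= /d dfwithin big_seq big1 ?addr0// => k.
      by rewrite !inE => /andP[ki _]; rewrite dfwithout// eq_sym.
    rewrite -sumrB; apply: eq_bigr => k _.
    by rewrite -scaleN1r addrC -adjoint_linear scaleN1r addrC.
  apply: le_trans (LA _ _); rewrite ler_pM2l// (big_fsetD1 j)//= lerDl.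
  by apply: sumr_ge0 => k _; exact: sqr_ge0.
have : A * rnorm (L j x - d j) ^+ 2 <= 0.
  by rewrite -(cvg_lim _ r0)//; apply: limr_ge => //; apply/cvg_ex; exists 0.
rewrite pmulr_rle0// le_eqVlt ltNge sqr_ge0 orbF sqrf_eq0 rnorm_eq0 subr_eq0.
by move=> /eqP.
Unshelve. all: by end_near. Qed.

(** The adjoint of U_i W is W' after the adjoint of U_i, and W' preserves inner products, while W
    preserves the norm in Parseval's identity. *)
Lemma onb_comp_unitary U (W W' : {linear H -> H}) hW :
  (forall x y, rinner (W x) y = rinner x (W' y)) ->
  cancel W W' -> cancel W' W ->
  g_orthonormal_basis U -> g_orthonormal_basis (fun i => comp_op (U i) (N := W) hW).
Proof.
move=> WW' WK W'K [Uin Uij Usum].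
have W'in x y : inner (W' x) (W' y) = inner x y.
  apply: inner_rinner => c.
  have -> : c *: W' x = W' (c *: x) by rewrite linearZ.
  by rewrite -WW' W'K.
split=> [i g h|i j g h ij|f].
- by rewrite !(adjoint_comp_op _ _ _ WW') W'in.
- by rewrite !(adjoint_comp_op _ _ _ WW') W'in Uij.
- have <- : rnorm (W f) ^+ 2 = rnorm f ^+ 2 by rewrite -!rinner_sqr WW' WK.
  by rewrite -Usum.
Qed.

End GRiesz.

(** * Combinations of two g-orthonormal bases against Riesz bounds *)

Theorem proposition2p2 (R : realType) (J : set int)
    (H : hilbertType R) (Hs : J -> hilbertType R)
    (sepH : separable H) (sepHs : forall i : J, separable (Hs i))
    (L : forall i : J, 'L(H, Hs i)) (frameL : g_frame L) :
  (exists (U G : forall i : J, 'L(H, Hs i)) (a b : R[i]),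
    [/\ g_orthonormal_basis U, g_orthonormal_basis G &
        forall (i : J) (f : H), L i f = a *: U i f + b *: G i f])
  <-> g_Riesz_basis L.
Proof.
have [A [B [A0 B0 LAB]]] := frameL.
split=> [[U [G [a [b [oU oG LE]]]]]|[_ [A' [B' [A'0 A'B' LR]]]]].
  split.
    apply/seteqP; split => f /= => [Lf|-> i _]; last by rewrite /= linear0.
    have /andP[+ _] := LAB f; rewrite esum1 => [|i _]; last first.
      by rewrite Lf// rnorm0 expr0n.
    rewrite lee_fin pmulr_rle0// le_eqVlt ltNge sqr_ge0 orbF sqrf_eq0 rnorm_eq0.
    by move=> /eqP.
  (* On a trivial space frame bounds need not satisfy A <= B, which a g-Riesz basis asks for; hence
     the maximum. *)
  exists A, (Num.max A B); split => // [|I g]; first by rewrite le_max lexx.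
  have := LAB (\sum_(i <- I) adjoint (U i) (g i)).
  rewrite (onb_comb_synthesis I g oU oG LE) !lee_fin onb_synthesis//.
  move=> /andP[-> /le_trans -> //]; rewrite ler_wpM2r ?le_max ?lexx ?orbT//.
  by apply: sumr_ge0 => i _; exact: sqr_ge0.
have B'0 : 0 < B' := lt_le_trans A'0 A'B'.
have [S LS] : exists S : {linear H -> H},
    forall f, \sum_(i <- exhaust n) adjoint (L i) (L i f) @[n --> \oo] --> S f.
  apply: (frame_operator_exists B'0) => [f|I g]; last by have /andP[] := LR I g.
  by have /andP[_] := LAB f; exact: esum_rnorm_fin.
have Ssym := frame_operator_sym LS; have Sesum := frame_operator_esum LS.
have SAB x : A * rnorm x ^+ 2 <= rinner (S x) x <= Num.max A B * rnorm x ^+ 2.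
  have := LAB x; rewrite Sesum !lee_fin => /andP[-> /le_trans -> //].
  by rewrite ler_wpM2r ?sqr_ge0// le_max lexx orbT.
have [|W [W' [a [b [WW' WK W'K SE]]]]] := abs_sqr_factor A0 _ Ssym SAB.
  by rewrite le_max lexx.
have W'W x y : rinner (W' x) y = rinner x (W y) by rewrite rinnerC -WW' rinnerC.
pose M : {linear H -> H} := a%:C%C \*: idfun \+ b%:C%C \*: W.
pose M' : {linear H -> H} := a%:C%C \*: idfun \+ b%:C%C \*: W'.
have ME x : M x = a%:C%C *: x + b%:C%C *: W x by [].
have M'E x : M' x = a%:C%C *: x + b%:C%C *: W' x by [].
have MM' x y : rinner (M x) y = rinner x (M' y).
  by rewrite ME M'E !rinnerE WW'.
(* One computation for both products: (P, Q) is (W, W') for M' M and (W', W) for M M'. *)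
have expand (P Q : {linear H -> H}) x : cancel P Q ->
    a%:C%C *: (a%:C%C *: x + b%:C%C *: P x) + b%:C%C *: Q (a%:C%C *: x + b%:C%C *: P x)
    = (a ^+ 2 + b ^+ 2)%:C%C *: x + (a * b)%:C%C *: (P x + Q x).
  move=> PQ; have -> : Q (a%:C%C *: x + b%:C%C *: P x) = a%:C%C *: Q x + b%:C%C *: x.
    by rewrite linearD linearZ; congr (_ + _); rewrite linearZ /= PQ.
  rewrite !scalerDr !scalerA -!rmorphM [b * a]mulrC !expr2 rmorphD scalerDl.
  by rewrite [_ *: Q x + _]addrC addrACA.
have M'M x : M' (M x) = S x by rewrite M'E ME expand// -SE.
have MM'S x : M (M' x) = S x by rewrite M'E ME expand// [W' x + _]addrC -SE.
have Ssurj y : exists x, S x = y.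
  have [x Sx] : exists z, forall x, rinner (S z) x = rinner y x.
    apply: (@coercive_solve _ _ S (rinner y) A (rnorm y)) => //.
    - by move=> x; have /andP[] := SAB x.
    - by move=> u v; rewrite rinnerDr.
    - by move=> c u; rewrite rinnerZr.
    - by move=> u; exact: rinner_abs.
  by exists x; apply: rinner_inj => z; rewrite rinnerC Sx rinnerC.
(* Both M and M' are bounded below because |M x|^2 = <S x, x> = |M' x|^2, and onto because S is and
   S = M M' = M' M. *)
have [||N [Nb MK NK]] := @bounded_below_inverse _ _ M A A0.
- move=> x; rewrite -[leRHS]rinner_sqr MM' M'M rinnerC.
  by have /andP[] := SAB x.
- by move=> y; have [x <-] := Ssurj y; exists (M' x).
have [||N' [_ M'K N'K]] := @bounded_below_inverse _ _ M' A A0.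
- move=> x; rewrite -[leRHS]rinner_sqr -MM' MM'S.
  by have /andP[] := SAB x.
- by move=> y; have [x <-] := Ssurj y; exists (M x).
have NN' x y : rinner (N x) y = rinner x (N' y).
  by rewrite -{1}[y]N'K -MM' NK.
have Wb : bounded_near W (nbhs (0 : H)).
  apply/rnorm_boundedP; exists 1 => // x; rewrite mul1r.
  by rewrite -(@ler_pXn2r _ 2)// ?nnegrE ?rnorm_ge0// -!rinner_sqr WW' WK.
pose U i := comp_op (L i) Nb; pose G i := comp_op (U i) Wb.
have oU : g_orthonormal_basis U.
  (* N N' is the inverse of S = M' M, so this is biorthogonality of L_j against S^-1 applied to the
     adjoint of L_i. *)
  have Lbi i (g : Hs i) j :
      L j (N (N' (adjoint (L i) g))) = dfwith (fun k => 0 : Hs k) i g j.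
    apply: (Riesz_biorthogonal A'0 LS) => [I h|]; first by have /andP[] := LR I h.
    by rewrite -M'M NK N'K.
  have Uin i j (g : Hs i) (h : Hs j) : inner (adjoint (U i) g) (adjoint (U j) h)
      = inner (dfwith (fun k => 0 : Hs k) i g j) h.
    rewrite !(adjoint_comp_op _ _ _ NN'); apply: inner_rinner => c.
    rewrite rinnerZC [RHS]rinnerZC -Lbi.
    have -> : c^*%C *: N' (adjoint (L j) h) = N' (c^*%C *: adjoint (L j) h).
      by rewrite linearZ.
    by rewrite -NN' -rinnerZ_adjoint rinnerZC.
  split=> [i g h|i j g h ij|f].
  - by rewrite Uin dfwithin.
  - by rewrite Uin dfwithout// linear0l.
  - by rewrite (Sesum (N f)) -M'M NK rinnerC -MM' NK rinner_sqr.
exists U, G, a%:C%C, b%:C%C; split => //; first exact: (onb_comp_unitary Wb WW').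
(* Writing f as N (M f) with M = a + b W turns L_i f into a L_i N f + b L_i N W f. *)
move=> i f; rewrite -[f in LHS]MK ME.
have -> : N (a%:C%C *: f + b%:C%C *: W f) = a%:C%C *: N f + b%:C%C *: N (W f).
  by rewrite linearD linearZ; congr (_ + _); rewrite linearZ.
by rewrite linearD linearZ; congr (_ + _); rewrite linearZ.
Qed.
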